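(* Let $X\neq\{0\}$ be a real Banach space and let $T:X\rightrightarrows X^*$ be a (non-empty) monotone, demiclosed operator whose domain $D(T)$ is not a singleton, with $\operatorname{ri}D(T)\neq\emptyset$ and $T=T+N_{\operatorname{aff}D(T)}$. Then the graph of $T$ is closed in $X\times X^*$ for the norm$\times$weak-star topology.
   Context: $X^*$ is the topological dual of $X$, $\langle x,x^*\rangle:=x^*(x)$. A multifunction $T:X\rightrightarrows X^*$ is identified with its graph $\{(x,x^* )\mid x^*\in T(x)\}$; $D(T)=\{x\mid T(x)\neq\emptyset\}$. $T$ is monotone if $\langle x_1-x_2,x_1^*-x_2^*\rangle\ge0$ for all $(x_1,x_1^* ),(x_2,x_2^* )\in T$. Sums are pointwise. $T$ is demiclosed if whenever $(x_i,x_i^* )_i$ is a net in the graph of $T$ with $x_i\to x_0$ in norm, $x_i^*\to x_0^*$ weakly-star and $(x_i^* )_i$ norm bounded, one has $(x_0,x_0^* )\in T$. $\operatorname{aff}S$ is the affine hull of $S$ and $\operatorname{ri}S$ is the interior of $S$ relative to the norm closure of $\operatorname{aff}S$. For $C\subset X$, $N_C(x)=\{x^*\in X^*\mid\langle y-x,x^*\rangle\le0\ \forall y\in C\}$ if $x\in C$, $N_C(x)=\emptyset$ otherwise. *)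

(* Defs.v *)
From HB Require Import structures.
From mathcomp Require Import all_boot all_order all_algebra.
From mathcomp Require Import all_classical all_reals all_analysis.

Set Implicit Arguments.
Unset Strict Implicit.
Unset Printing Implicit Defensive.
Import Order.TTheory GRing.Theory Num.Theory.
Import numFieldNormedType.Exports.
Local Open Scope classical_set_scope.
Local Open Scope ring_scope.

Section topological_dual.
Context {R : realType} (X : normedModType R).

Definition continuous_linear_form : {pred X -> R} :=
  [pred f | `[< linear (f : X -> R^o) /\ continuous f >]].

(** [topdual X] is X^*; the pairing <x, x^*> is the application [xs x]. *)
Record topdual := TopDual {
  topdual_fun :> X -> R ;
  topdual_funP : topdual_fun \in continuous_linear_form }.

HB.instance Definition _ := [isSub for topdual_fun].
HB.instance Definition _ := [Choice of topdual by <:].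

Lemma continuous_linear_form_submod_closed :
  submod_closed continuous_linear_form.
Proof.
split=> [|a f g /asboolP[lf cf] /asboolP[lg cg]]; apply/asboolP; split.
- by move=> a u v /=; rewrite /GRing.zero/= scaler0 addr0.
- by move=> x; exact: cvg_cst.
- move=> b u v; have := lf b u v; have := lg b u v.
  rewrite /= => lg' lf'.
  transitivity (a * f (b *: u + v) + g (b *: u + v)) => //.
  rewrite lf' lg' /GRing.scale/= !mulrDr addrACA; congr (_ + _).
  by rewrite !mulrA (mulrC a).
- move=> x; apply: (@cvgD _ R^o); last exact: cg.
  by apply: cvgM; [exact: cvg_cst|exact: cf].
Qed.

HB.instance Definition _ :=
  GRing.isSubmodClosed.Build R (X -> R^o) continuous_linear_form
    continuous_linear_form_submod_closed.
HB.instance Definition _ := [SubChoice_isSubLmodule of topdual by <:].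

Definition dual_norm (xs : topdual) : R :=
  sup [set `|xs x| | x in [set x : X | `|x| <= 1]].

(** [topdual] with the topology induced by pointwise convergence on X. *)
Definition weak_star : Type :=
  initial_topology (fun xs : topdual => (xs : X -> R) : {ptws X -> R}).

HB.instance Definition _ := Topological.on weak_star.

End topological_dual.

Section nets.

Definition directed_preorder (I : Type) (le : I -> I -> Prop) : Prop :=
  [/\ (exists i : I, True),
      (forall i, le i i),
      (forall i j k, le i j -> le j k -> le i k) &
      (forall i j, exists k, le i k /\ le j k)].

(** The filter of the sets that contain a tail of the index set: a net
    [x : I -> T] converges to [l] iff [x @ net_tails le --> l]. *)
Definition net_tails (I : Type) (le : I -> I -> Prop) : set_system I :=
  [set A | exists i0, forall i, le i0 i -> A i].

Lemma net_tails_proper (I : Type) (le : I -> I -> Prop) :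
  directed_preorder le -> ProperFilter (net_tails le).
Proof.
move=> [[i0 _] refl trans dir]; apply: Build_ProperFilter_ex.
  by move=> A [i Ai]; exists i; apply: Ai.
split; first by exists i0.
- move=> A B [i Ai] [j Bj]; have [k [ik jk]] := dir i j.
  by exists k => l kl; split; [apply: Ai|apply: Bj]; apply: trans kl.
- by move=> A B AB [i Ai]; exists i => j /Ai /AB.
Qed.

End nets.

Section affine.
Context {R : realType} {X : normedModType R}.

Definition affine_set (A : set X) : Prop :=
  forall x y (t : R), A x -> A y -> A ((1 - t) *: x + t *: y).

Definition aff (S : set X) : set X := smallest affine_set S.

(** [subspace A] is the whole carrier, with the points outside [A] isolated;
    as [S] is included in [closure (aff S)], the interior below is exactly
    the interior of [S] relative to [closure (aff S)]. *)
Definition ri (S : set X) : set X :=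
  interior (S : set (subspace (closure (aff S)))).

End affine.

Section multifunctions.
Context {R : realType} {X : normedModType R}.
Implicit Types S T : X -> set (topdual X).

Definition graph T : set (X * topdual X) := [set p | T p.1 p.2].

Definition domain T : set X := [set x | T x !=set0].

Definition monotone_op T : Prop :=
  forall x1 x2 (x1s x2s : topdual X),
    T x1 x1s -> T x2 x2s -> 0 <= (x1s - x2s) (x1 - x2).

Definition add_op S T : X -> set (topdual X) :=
  fun x => [set xs + ys | xs in S x & ys in T x].

Definition normal_cone (C : set X) : X -> set (topdual X) :=
  fun x => [set xs | C x /\ forall y, C y -> xs (y - x) <= 0].

Definition demiclosed T : Prop :=
  forall (I : Type) (le : I -> I -> Prop)
      (x : I -> X) (xs : I -> topdual X) (x0 : X) (x0s : topdual X),
    directed_preorder le ->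
    (forall i, T (x i) (xs i)) ->
    x @ net_tails le --> x0 ->
    (xs : I -> weak_star X) @ net_tails le --> (x0s : weak_star X) ->
    (exists M : R, forall i, dual_norm (xs i) <= M) ->
    T x0 x0s.

End multifunctions.

(* Main.v *)
Require Import Defs.
From HB Require Import structures.
From mathcomp Require Import all_boot all_order all_algebra.
From mathcomp Require Import all_classical all_reals all_analysis.
From mathcomp Require Import ring lra zify.
Import Order.TTheory GRing.Theory Num.Theory.
Import numFieldNormedType.Exports.
Local Open Scope classical_set_scope.
Local Open Scope ring_scope.

(** Let [(x, xs)] be in the closure of the graph and [a] in [ri D(T)]. Then
    [aff D(T)] is closed, with closed direction space [L], and a ball around
    [a] in [a + L] lies in [D(T)]. Monotonicity and the uniform boundedness
    principle on [L] bound the restriction to [L] of [q], for [(p, q)] in the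
    graph with [p] near [x], by [K (1 + |q (p - a)|)]; if moreover [(p, q)] is
    close to [(x, xs)], this improves to a fixed bound [C]. By Hahn-Banach
    there is a functional [g] of norm at most [C] that agrees with [q] on [L],
    and [g] is in [T p] because [T = T + N_(aff D(T))]. Along an ultrafilter
    these bounded [g] converge weakly-star to some [y], which is in [T x] by
    demiclosedness and agrees with [xs] on [L]; hence [xs] is in [T x]. *)

Set Implicit Arguments.
Unset Strict Implicit.
Unset Printing Implicit Defensive.

(** * Sublinear functionals and the dominated Hahn-Banach theorem *)

Section sublinear.
Context {R : realType} {V : lmodType R}.
Implicit Types (p q : V -> R) (K : set (V * R)).

Definition sublinear p : Prop :=
  (forall u v, p (u + v) <= p u + p v) /\
  (forall (t : R) v, 0 <= t -> p (t *: v) <= t * p v).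

Lemma sublinear_geN p v : sublinear p -> - p (- v) <= p v.
Proof.
move=> [pD pZ]; have := pD v (- v); have := pD 0 0.
rewrite subrr addr0; lra.
Qed.

Definition convex_cone K : Prop :=
  [/\ K (0, 0),
      (forall a b, K a -> K b -> K (a.1 + b.1, a.2 + b.2)) &
      (forall (t : R) a, 0 <= t -> K a -> K (t *: a.1, t * a.2))].

(** Infimal convolution of [p] with the cone [K]: the greatest sublinear
    [q <= p] such that [s <= - q (- u)] for all [(u, s)] in [K]. *)
Definition cone_inf p K v : R := inf [set p (v + a.1) - a.2 | a in K].

(** As [K] lies below [p], the set is bounded below by [- p (- v)], so [inf] is a true infimum and
    not a default value. *)
Lemma cone_inf_le p K v a : sublinear p -> (forall b, K b -> b.2 <= p b.1) ->
  K a -> cone_inf p K v <= p (v + a.1) - a.2.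
Proof.
move=> [pD _] Kp Ka; apply: ge_inf; last by exists a.
exists (- p (- v)) => _ [b Kb <-]; have := Kp _ Kb.
have := pD (- v) (v + b.1); rewrite addKr; lra.
Qed.

Lemma le_cone_inf p K v (m : R) : convex_cone K ->
  (forall a, K a -> m <= p (v + a.1) - a.2) -> m <= cone_inf p K v.
Proof.
move=> [K0 _ _] Km; apply: lb_le_inf.
  by exists (p (v + (0 : V)) - 0), (0, 0).
by move=> _ [a Ka <-]; exact: Km.
Qed.

Lemma sublinear_cone_inf p K : sublinear p -> convex_cone K ->
  (forall a, K a -> a.2 <= p a.1) -> sublinear (cone_inf p K).
Proof.
move=> sp cK Kp; have [pD pZ] := sp; have [K0 KD KZ] := cK; split.
  move=> u v; rewrite -lerBlDr; apply: le_cone_inf => // a Ka.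
  rewrite lerBlDl -lerBlDr; apply: le_cone_inf => // b Kb.
  rewrite lerBlDl.
  apply: (le_trans (cone_inf_le _ sp Kp (KD _ _ Ka Kb))) => /=.
  rewrite addrACA; have := pD (u + a.1) (v + b.1); lra.
move=> t v t0; have [->|tn0] := eqVneq t 0.
  rewrite scale0r mul0r.
  apply: (le_trans (cone_inf_le _ sp Kp K0)) => /=.
  have := pZ 0 0 (lexx 0); rewrite scale0r addr0; lra.
have tgt0 : 0 < t by rewrite lt_neqAle eq_sym tn0.
rewrite -ler_pdivrMl//; apply: le_cone_inf => // a Ka; rewrite ler_pdivrMl//.
apply: (le_trans (cone_inf_le _ sp Kp (KZ t _ t0 Ka))) => /=.
by rewrite -scalerDr mulrBr lerB// pZ.
Qed.

(** Zorn's lemma for the reversed pointwise order. Pointwise infima of chains are finite because a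
    sublinear [q <= p] satisfies [- p (- v) <= q v]. *)
Lemma exists_minimal_sublinear p : sublinear p ->
  exists q, [/\ sublinear q, (forall v, q v <= p v) &
    forall q', sublinear q' -> (forall v, q' v <= q v) -> q' = q].
Proof.
move=> sp.
pose T := {q : V -> R | sublinear q /\ forall v, q v <= p v}.
pose ge (q1 q2 : T) := `[< forall v, sval q2 v <= sval q1 v >].
have [||||[q [sq qp]] qmin] := @Zorn T ge.
- by move=> q; apply/asboolP.
- move=> a b c /asboolP ab /asboolP bc; apply/asboolP => v.
  exact: le_trans (bc v) (ab v).
- move=> [a a'] [b b'] /asboolP ab /asboolP ba.
  by apply: eq_exist; apply/funext => v; apply/le_anti; rewrite ab ba.
- move=> A Atot.
  have [[q0 Aq0]|A0] := pselect (A !=set0); last first.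
    exists (exist _ p (conj sp (fun v => lexx (p v)))) => s As.
    by exfalso; apply: A0; exists s.
  pose m v := inf [set (sval q : V -> R) v | q in A].
  have m_le v (q : T) : A q -> m v <= sval q v.
    move=> Aq; apply: ge_inf; last by exists q.
    exists (- p (- v)) => _ [[r [sr rp]] _ <-] /=.
    by apply: le_trans (sublinear_geN v sr); rewrite lerN2 rp.
  have le_m v (x : R) : (forall q : T, A q -> x <= sval q v) -> x <= m v.
    move=> h; apply: lb_le_inf; first by exists (sval q0 v), q0.
    by move=> _ [q Aq <-]; exact: h.
  have sm : sublinear m.
    split=> [u v|t v t0].
      rewrite -lerBlDr; apply: (le_m _ _) => q Aq; rewrite lerBlDl -lerBlDr.
      apply: (le_m _ _) => q' Aq'; rewrite lerBlDl.
      (* The smaller of the two chain members serves for both [u] and [v]. *)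
      have [/asboolP le|/asboolP le] := Atot _ _ Aq Aq'.
        have [[qD _] _] := svalP q'.
        have := le u; have := qD u v; have := m_le (u + v) _ Aq'; lra.
      have [[qD _] _] := svalP q.
      have := le v; have := qD u v; have := m_le (u + v) _ Aq; lra.
    have [->|tn0] := eqVneq t 0.
      have [[_ qZ] _] := svalP q0.
      apply: le_trans (m_le _ _ Aq0) _.
      by rewrite (le_trans (qZ _ _ _))// !mul0r.
    have tgt0 : 0 < t by rewrite lt_neqAle eq_sym tn0.
    rewrite -ler_pdivrMl//; apply: (le_m _ _) => q Aq; rewrite ler_pdivrMl//.
    have [[_ qZ] _] := svalP q.
    exact: le_trans (m_le _ _ Aq) (qZ _ _ t0).
  have mp v : m v <= p v.
    by apply: le_trans (m_le v _ Aq0) _; case: (svalP q0).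
  exists (exist _ m (conj sm mp)) => q Aq; apply/asboolP => v /=.
  exact: m_le.
exists q; split=> // q' sq' q'q.
have q'p v : q' v <= p v by exact: le_trans (q'q v) (qp v).
have /= := qmin (exist _ q' (conj sq' q'p)).
by move=> /(_ (asboolT q'q)) /(congr1 sval).
Qed.

(** Minimality is applied to [v |-> inf_(t >= 0) q (v + t a) - t q a]; the
    choice [t = 1] then gives [q v + q a <= q (v + a)]. *)
Lemma minimal_sublinear_linear q : sublinear q ->
  (forall q', sublinear q' -> (forall v, q' v <= q v) -> q' = q) ->
  linear (q : V -> R^o).
Proof.
move=> sq qmin; have [qD qZ] := sq.
have qadd u a : q (u + a) = q u + q a.
  apply/le_anti; rewrite qD/=.
  pose K : set (V * R) := [set (t *: a, t * q a) | t in [set t : R | 0 <= t]].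
  have cK : convex_cone K.
    split; first by exists 0; rewrite /= ?lexx// scale0r mul0r.
      move=> _ _ [t t0 <-] [s s0 <-]; exists (t + s); first exact: addr_ge0.
      by rewrite scalerDl mulrDl.
    move=> t _ t0 [s s0 <-]; exists (t * s); first exact: mulr_ge0.
    by rewrite scalerA mulrA.
  have Kq b : K b -> b.2 <= q b.1.
    move=> [t t0 <-] /=; have := sublinear_geN (t *: a) sq.
    have := qD (t *: a) (- (t *: a)).
    have [->|tn0] := eqVneq t 0; first by rewrite scale0r mul0r oppr0; lra.
    have tgt0 : 0 < t by rewrite lt_neqAle eq_sym tn0.
    rewrite -ler_pdivlMl// => _ _.
    by rewrite -[X in q X <= _](scalerK tn0) qZ// invr_ge0.
  have Kqq : cone_inf q K = q.
    apply: qmin; first exact: sublinear_cone_inf.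
    move=> v; have [K0 _ _] := cK.
    by have := cone_inf_le v sq Kq K0; rewrite /= addr0 subr0.
  have K1 : K (a, q a) by exists 1; rewrite /= ?ler01// scale1r mul1r.
  by have := cone_inf_le u sq Kq K1; rewrite Kqq /= lerBrDr.
have q0 : q 0 = 0.
  by have := qadd 0 0; rewrite addr0; lra.
have qN v : q (- v) = - q v.
  by have := qadd v (- v); rewrite subrr q0; lra.
have qZ' (t : R) v : 0 <= t -> q (t *: v) = t * q v.
  move=> t0; have := qZ _ v t0; have := qZ _ (- v) t0.
  by rewrite scalerN !qN; lra.
move=> t u v; rewrite qadd; congr (_ + _); rewrite /GRing.scale/=.
have [t0|t0] := leP 0 t; first exact: qZ'.
have := qZ' (- t) u; rewrite scaleNr qN oppr_ge0 (ltW t0) => /(_ isT).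
by rewrite mulNr => /oppr_inj ->.
Qed.

(** Values prescribed on a subspace enter by applying this to [cone_inf], whose cone carries
    them. *)
Lemma exists_linear_le_sublinear p : sublinear p ->
  exists f : V -> R, linear (f : V -> R^o) /\ forall v, f v <= p v.
Proof.
move=> /exists_minimal_sublinear[q [sq qp qmin]].
by exists q; split=> //; exact: minimal_sublinear_linear.
Qed.

End sublinear.

(** * Continuous linear functionals and norm-controlled extension *)

Section topdual_theory.
Context {R : realType} {X : normedModType R}.
Implicit Types (f : topdual X) (L : set X).

Lemma topdual_linear f : linear (f : X -> R^o).
Proof. by have /asboolP[] := topdual_funP f. Qed.

Lemma topdual_continuous f : continuous f.
Proof. by have /asboolP[] := topdual_funP f. Qed.

Lemma topdualD f u v : f (u + v) = f u + f v.
Proof. by have := topdual_linear f 1 u v; rewrite !scale1r. Qed.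

Lemma topdual0 f : f 0 = 0.
Proof. by have := topdualD f 0 0; rewrite addr0; lra. Qed.

Lemma topdualZ f (t : R) v : f (t *: v) = t * f v.
Proof. by have := topdual_linear f t v 0; rewrite !addr0 topdual0 addr0. Qed.

Lemma topdualN f v : f (- v) = - f v.
Proof. by rewrite -scaleN1r topdualZ mulN1r. Qed.

Lemma topdualB f u v : f (u - v) = f u - f v.
Proof. by rewrite topdualD topdualN. Qed.

Lemma bounded_linear_topdual (g : X -> R) (C : R) :
  linear (g : X -> R^o) -> (forall v, `|g v| <= C * `|v|) ->
  exists f, forall v, f v = g v.
Proof.
move=> lg gC.
have gB u v : g (u - v) = g u - g v.
  by rewrite addrC -scaleN1r lg scaleN1r addrC.
have cg : continuous g.
  move=> x; apply/cvgrPdist_lt => e e0; near=> y.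
  rewrite -gB; apply: le_lt_trans (gC _) _.
  have C1 : 0 < `|C| + 1 by rewrite ltr_pwDr.
  apply: (@le_lt_trans _ _ ((`|C| + 1) * `|x - y|)).
    by rewrite ler_wpM2r// (le_trans (ler_norm _))// lerDl.
  rewrite -ltr_pdivlMl//; near: y.
  have /cvgrPdist_lt : y @[y --> x] --> x by exact: cvg_id.
  by apply; rewrite mulr_gt0 ?invr_gt0.
have gP : g \in @continuous_linear_form R X by apply/asboolP.
by exists (TopDual gP).
Unshelve. all: by end_near. Qed.

Lemma topdual_norm_le f (C : R) : (forall v, f v <= C * `|v|) ->
  forall v, `|f v| <= C * `|v|.
Proof.
move=> fC v; rewrite ler_norml fC andbT lerNl -topdualN.
by rewrite (le_trans (fC _))// normrN.
Qed.

Lemma dual_norm_le f (C : R) : 0 <= C ->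
  (forall v, `|f v| <= C * `|v|) -> dual_norm f <= C.
Proof.
move=> C0 fC; apply: ge_sup; first by exists `|f 0|, 0; rewrite //= normr0.
move=> _ [v /= v1 <-]; apply: le_trans (fC v) _.
by rewrite -[leRHS]mulr1 ler_wpM2l.
Qed.

Lemma topdual_bounded f : exists2 M : R, 0 <= M &
  forall v, `|f v| <= M * `|v|.
Proof.
have /cvgrPdist_lt/(_ 1 ltr01) := topdual_continuous (f := f) (x := 0).
move=> /nbhs_ballP[r /= r0 fr]; exists (2 / r); first by rewrite divr_ge0// ltW.
move=> v; have [->|v0] := eqVneq v 0; first by rewrite topdual0 !normr0 mulr0.
have nv : 0 < `|v| by rewrite normr_gt0.
(* On the ball of radius [r], [|f|] stays below 1; rescaling [v] to norm [r / 2] yields the constant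
   [2 / r]. *)
have := fr ((r / 2 / `|v|) *: v).
rewrite -ball_normE /= sub0r normrN normrZ topdual0 sub0r normrN topdualZ.
have q0 : 0 < r / 2 / `|v| by rewrite !divr_gt0.
rewrite [`|_ * f v|]normrM (gtr0_norm q0) divfK ?gt_eqF//.
have r2 : r / 2 < r by lra.
move=> /(_ r2) h.
have -> : 2 / r * `|v| = (r / 2 / `|v|)^-1 by field; rewrite !gt_eqF.
by rewrite ltW// -[ltRHS]mulr1 ltr_pdivlMl.
Qed.

Definition subspace_set L : Prop :=
  [/\ L 0, (forall u v, L u -> L v -> L (u + v)) &
      (forall (t : R) v, L v -> L (t *: v))].

(** Take for cone the graph of [f] over [L]. A linear [g <= cone_inf p K] is below [p] by the choice
    [(0, 0)], and below [f] on [L] by the choice [(- v, f (- v))]; passing to [- v] gives equality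
    on [L]. *)
Lemma topdual_extension L f (C : R) : subspace_set L -> 0 <= C ->
  (forall v, L v -> f v <= C * `|v|) ->
  exists g : topdual X, (forall v, L v -> g v = f v) /\
    forall v, `|g v| <= C * `|v|.
Proof.
move=> [L0 LD LZ] C0 fC.
pose p (v : X) := C * `|v|.
have sp : sublinear p.
  split=> [u v|t v t0]; first by rewrite -mulrDr ler_wpM2l// ler_normD.
  by rewrite /p normrZ ger0_norm// mulrCA.
pose K : set (X * R) := [set (u, f u) | u in L].
have cK : convex_cone K.
  split; first by exists 0 => //; rewrite topdual0.
    move=> _ _ [u Lu <-] [v Lv <-].
    by exists (u + v); rewrite ?topdualD//; exact: LD.
  by move=> t _ _ [u Lu <-]; exists (t *: u); rewrite ?topdualZ//; exact: LZ.
have Kp a : K a -> a.2 <= p a.1 by move=> [u Lu <-]; exact: fC.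
have [g [lg gp]] := exists_linear_le_sublinear (sublinear_cone_inf sp cK Kp).
have [K0 _ _] := cK.
have g_le v : g v <= C * `|v|.
  apply: le_trans (gp v) _; apply: le_trans (cone_inf_le _ sp Kp K0) _.
  by rewrite /= addr0 subr0.
have gN v : g (- v) = - g v.
  have := lg (-1) v v; have := lg 1 0 0; have := lg (-1) v 0.
  by rewrite !scaleN1r !scale1r !addr0 addNr; lra.
have gL v : L v -> g v <= f v.
  move=> Lv; apply: le_trans (gp v) _.
  have KNv : K (- v, f (- v)).
    by exists (- v) => //; rewrite -scaleN1r; exact: LZ.
  apply: le_trans (cone_inf_le _ sp Kp KNv) _.
  by rewrite /p /= subrr normr0 topdualN; lra.
have [h hg] : exists h : topdual X, forall v, h v = g v.
  apply: (@bounded_linear_topdual g C lg) => v; rewrite ler_norml g_le andbT.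
  by rewrite lerNl -gN (le_trans (g_le _))// normrN.
exists h; split=> [v Lv|]; last first.
  by apply: topdual_norm_le => v; rewrite hg.
rewrite hg; apply/le_anti; rewrite gL//=.
have : L (- v) by rewrite -scaleN1r; exact: LZ.
by move/gL; rewrite gN topdualN lerN2.
Qed.

End topdual_theory.

(** * Uniform boundedness on a closed subspace *)

Section uniform_boundedness.
Context {R : realType} {X : completeNormedModType R}.

(** Nested balls [B(a_n, r_n)] centred in [L], such that every point of
    [B(a_(n+1), r_(n+1))] is sent above [n] by a member of [F]. *)
Lemma closed_subspace_uniform_boundedness (L : set X) (F : set (topdual X)) :
  subspace_set L -> closed L ->
  (forall v, L v -> exists M : R, forall f, F f -> f v <= M) ->
  exists2 K : R, 0 <= K & forall f, F f -> forall v, L v -> f v <= K * `|v|.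
Proof.
move=> [L0 LD LZ] Lcl Fbd.
(* If [F] is bounded above on some ball relative to [L], the bound at [- a] moves that ball to the
   origin and gives [K]. Otherwise the nested balls can be built. *)
have [[a [n [r [La r0 Far]]]]|nbd] := pselect (exists a (n r : R),
    [/\ L a, 0 < r & forall f b, F f -> L b -> `|b - a| <= r -> f b <= n]).
  have [M FM] : exists M : R, forall f, F f -> f (- a) <= M.
    by apply: Fbd; rewrite -scaleN1r; exact: LZ.
  have N0 : 0 <= `|n| + `|M| by rewrite addr_ge0.
  exists ((`|n| + `|M|) / r) => [|f Ff v Lv]; first by rewrite divr_ge0// ltW.
  have [->|v0] := eqVneq v 0; first by rewrite topdual0 normr0 mulr0.
  have nv : 0 < `|v| by rewrite normr_gt0.
  have q0 : 0 < r / `|v| by rewrite divr_gt0.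
  have := Far _ (a + (r / `|v|) *: v) Ff (LD _ _ La (LZ _ _ Lv)).
  rewrite addrC addKr normrZ (gtr0_norm q0) divfK ?gt_eqF// lexx => /(_ isT).
  rewrite topdualD topdualZ => h.
  have -> : (`|n| + `|M|) / r * `|v| = (r / `|v|)^-1 * (`|n| + `|M|).
    by field; rewrite !gt_eqF.
  rewrite ler_pdivlMl//; have := FM _ Ff; rewrite topdualN.
  have := ler_norm n; have := ler_norm M; lra.
exfalso.
(* The conditions on [s] are premises, so that [choice] gives a step function defined on all
   pairs. *)
have step (n : nat) (s : X * R) : exists s' : X * R, L s.1 -> 0 < s.2 ->
    [/\ L s'.1, 0 < s'.2, s'.2 <= s.2 / 2, `|s'.1 - s.1| <= s.2 / 2 &
      forall x, `|x - s'.1| <= s'.2 -> exists2 f, F f & n%:R < f x].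
  have [[Ls s0]|ns] := pselect (L s.1 /\ 0 < s.2); last first.
    by exists s => Ls s0; exfalso; exact: ns.
  have [f [b [Ff Lb bs fb]]] : exists f b,
      [/\ F f, L b, `|b - s.1| <= s.2 / 2 & n%:R < f b].
    apply: contrapT => h; apply: nbd; exists s.1, n%:R, (s.2 / 2).
    split=> //; first by rewrite divr_gt0.
    move=> f b Ff Lb bs; rewrite leNgt; apply/negP => fb.
    by apply: h; exists f, b.
  have e0 : 0 < f b - n%:R by rewrite subr_gt0.
  have /cvgrPdist_lt/(_ _ e0) := topdual_continuous (f := f) (x := b).
  move=> /nbhs_ballP[r /= r0 fr].
  (* Halving [r] keeps the new closed ball inside the open one on which [f] exceeds [n]. *)
  have r'0 : 0 < Num.min (s.2 / 2) (r / 2) by rewrite lt_min !divr_gt0.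
  exists (b, Num.min (s.2 / 2) (r / 2)) => _ _; split=> //=.
    by rewrite ge_min lexx.
  move=> x; rewrite le_min => /andP[_ xb]; exists f => //.
  have /fr : ball b r x by rewrite -ball_normE /= distrC; lra.
  by rewrite ltr_norml; lra.
have [g0 gP] := choice (fun ns : nat * (X * R) => step ns.1 ns.2).
pose g n s := g0 (n, s).
pose s := fix s n := if n is m.+1 then g m (s m) else (0 : X, 1 : R).
have sL n : L (s n).1 /\ 0 < (s n).2.
  by elim: n => [//|n [Ln sn]] /=; have [] := gP (n, s n) Ln sn.
have sS n : [/\ (s n.+1).2 <= (s n).2 / 2,
    `|(s n.+1).1 - (s n).1| <= (s n).2 / 2 &
    forall x, `|x - (s n.+1).1| <= (s n.+1).2 -> exists2 f, F f & n%:R < f x].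
  by have [Ln sn] := sL n; have [] := gP (n, s n) Ln sn.
have s_nested n k : `|(s (k + n)%N).1 - (s n).1| + (s (k + n)%N).2 <= (s n).2.
  elim: k => [|k IH]; first by rewrite add0n subrr normr0 add0r.
  have [h1 h2 _] := sS (k + n)%N; rewrite addSn.
  have := ler_distD (s (k + n)%N).1 (s (k + n).+1).1 (s n).1; lra.
have s_small n : (s n).2 <= n.+1%:R^-1.
  elim: n => [|n IH]; first by rewrite /= invr1.
  have [h1 _ _] := sS n; apply: le_trans h1 _.
  rewrite ler_pdivrMr//; apply: le_trans IH _.
  by rewrite ler_pdivlMl// ler_pdivrMr// -natrM ler_nat; lia.
have : cauchy ((fun n => (s n).1) @ \oo).
  apply: cauchy_exP => e e0.
  have [N _ hN] := near_infty_natSinv_lt (PosNum e0).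
  exists (s N).1; exists N => // n /= Nn.
  rewrite -ball_normE /= distrC.
  have := s_nested N (n - N)%N; rewrite subnK// => h.
  have := le_lt_trans (s_small N) (hN N (leqnn N)); have := (sL n).2 => /=; lra.
move=> /cauchy_cvg/cvg_ex[/= x sx].
have Lx : L x.
  by apply: (closed_cvg L _ _ _ sx) => //; apply: nearW => n; exact: (sL n).1.
have xs n : `|x - (s n).1| <= (s n).2.
  rewrite distrC.
  apply: (closed_cvg (closed_ball_ Num.norm (s n).1 (s n).2) _ _ _ sx).
    exact: closed_closed_ball_.
  exists n => // m /= nm; rewrite /closed_ball_ /= distrC.
  have := s_nested n (m - n)%N; rewrite subnK//; have := (sL m).2; lra.
have [M FM] := Fbd _ Lx.
(* This index [n] exceeds [|M|], and some [f] in [F] exceeds [n] at [x], against [f x <= M]. *)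
have [_ _ h] := sS (Num.truncn `|M|).+1.
have [f Ff fx] := h _ (xs _).
have := FM _ Ff; have := truncnS_gt `|M|; have := ler_norm M; lra.
Qed.

End uniform_boundedness.

(** * Weak-star limits along filters and ultrafilters *)

Section demiclosed_ultrafilter.
Context {R : realType} {X : normedModType R}.

Lemma cvg_weak_star (I : Type) (F : set_system I) (FF : Filter F)
    (xs : I -> topdual X) (l : topdual X) :
  (forall v, xs i v @[i --> F] --> l v) ->
  (xs : I -> weak_star X) @ F --> (l : weak_star X).
Proof.
move=> h.
have : {ptws, (fun i => xs i : X -> R) @ F --> (l : X -> R)}.
  exact/pointwise_cvgP.
move=> ptcv A /= [_ [[B Bop <-] Bl sB]].
by apply: filterS sB _; apply: ptcv; exact: open_nbhs_nbhs.
Qed.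

Lemma weak_star_eval_continuous (v : X) :
  continuous ((fun f : weak_star X => topdual_fun f v) : weak_star X -> R).
Proof.
move=> f.
have := @initial_continuous (topdual X) {ptws X -> R}
  (fun xs : topdual X => (xs : X -> R)) f.
move=> h; apply: (pointwise_cvgP _ _).1 h v.
exact: (@fmap_filter _ _ _ _ (nbhs_filter (f : weak_star X))).
Qed.

(** Compactness of [[- C, C]] gives a cluster point, and an ultrafilter converges to each of its
    cluster points. *)
Lemma ultra_bounded_cvg (I : Type) (U : set_system I) (UU : UltraFilter U)
    (g : I -> R) (C : R) :
  (\forall i \near U, `|g i| <= C) -> exists l : R, g i @[i --> U] --> l.
Proof.
move=> gC.
have : (g @ U) `[- C, C]%classic.
  by apply: filterS gC => i; rewrite /= in_itv /= ler_norml.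
move=> /(@segment_compact _ (- C) C (g @ U) _)[l [_ lcl]]; exists l.
move=> B lB; have [//|UnB] := in_ultra_setVsetC (g @^-1` B) UU.
have [y [nBy By]] := lcl (~` B) B UnB lB.
by [].
Qed.

(** The graph points of [T] along [U] form a net indexed by the pairs
    [(A, i)] with [U A] and [A i], ordered by reverse inclusion of [A]. *)
Lemma demiclosed_filter (T : X -> set (topdual X)) (I : Type)
    (U : set_system I) (UF : ProperFilter U) (h : I -> X) (g : I -> topdual X)
    (x : X) (y : topdual X) (C : R) :
  demiclosed T -> 0 <= C ->
  (\forall i \near U, T (h i) (g i) /\ forall v, `|g i v| <= C * `|v|) ->
  h @ U --> x -> (forall v, g i v @[i --> U] --> y v) -> T x y.
Proof.
move=> dT C0 UG hx gy.
set G := [set i | T (h i) (g i) /\ forall v, `|g i v| <= C * `|v|].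
(* Requiring [G] of each index makes graph membership and the norm bound hold along the whole net,
   as [demiclosed] demands, and not just eventually. *)
pose J := {Ai : set I * I | [/\ U Ai.1, Ai.1 Ai.2 & G Ai.2]}.
pose le (a b : J) := (sval b).1 `<=` (sval a).1.
pose idx (a : J) : I := (sval a).2.
have mkJ A : U A -> exists a : J, (sval a).1 = A.
  move=> UA; have [i [Ai Gi]] := filter_ex (filterI UA UG).
  by exists (exist _ (A, i) (And3 UA Ai Gi)).
have dirJ : directed_preorder le.
  split.
  - by have [a _] := mkJ setT filterT; exists a.
  - by move=> a.
  - by move=> a b c ab bc; exact: subset_trans bc ab.
  - move=> a b.
    have [c cE] : exists c : J, (sval c).1 = (sval a).1 `&` (sval b).1.
      by apply: mkJ; apply: filterI; [case: (svalP a)|case: (svalP b)].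
    by exists c; split; rewrite /le cE; [exact: subIsetl|exact: subIsetr].
have tailsU : idx @ net_tails le --> U.
  move=> A UA; have [a aE] := mkJ A UA; exists a => b ab.
  by have [_ bi _] := svalP b; rewrite -aE; exact: ab.
have tailsF := net_tails_proper dirJ.
apply: (dT J le (h \o idx) (g \o idx)) => //.
- by move=> a; have [_ _ []] := svalP a.
- exact: cvg_comp tailsU hx.
- apply: cvg_weak_star => v; exact: cvg_comp tailsU (gy v).
- by exists C => a; have [_ _ [_ gC]] := svalP a; exact: dual_norm_le.
Qed.

(** This does the work of the Banach-Alaoglu theorem: pointwise limits exist by boundedness, and
    linearity and the bound [C] pass to the limit. *)
Lemma topdual_ultra_limit (I : Type) (U : set_system I) (UU : UltraFilter U)
    (g : I -> topdual X) (C : R) :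
  (\forall i \near U, forall v, `|g i v| <= C * `|v|) ->
  exists y : topdual X, forall v, g i v @[i --> U] --> y v.
Proof.
move=> UG.
have /choice[l lP] v : exists l : R, g i v @[i --> U] --> l.
  apply: (@ultra_bounded_cvg _ _ _ _ (C * `|v|)).
  by apply: filterS UG => i; exact.
have ll : linear (l : X -> R^o).
  move=> a u v; apply: (cvg_unique _ (lP _)); first exact: Rhausdorff.
  have /= -> : (fun i => g i (a *: u + v)) = (fun i => a * g i u + g i v).
    by apply/funext => i; rewrite topdualD topdualZ.
  apply: (@cvgD _ R^o); last exact: lP.
  by apply: cvgM; [exact: cvg_cst|exact: lP].
have lC v : `|l v| <= C * `|v|.
  apply: (closed_cvg [set r | r <= C * `|v|] _ _ _ (cvg_norm (lP v))).
    exact: closed_le.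
  by apply: filterS UG => i; exact.
have [y yl] := bounded_linear_topdual ll lC.
by exists y => v; rewrite yl; exact: lP.
Qed.

End demiclosed_ultrafilter.

(** * Affine hulls and relative interiors *)

Section affine_theory.
Context {R : realType} {X : normedModType R}.
Implicit Types (A S : set X).

Lemma affine_set_aff S : affine_set (aff S).
Proof.
move=> x y t Sx Sy B [affB SB].
by apply: (affB); [exact: (Sx B (conj affB SB))|exact: (Sy B (conj affB SB))].
Qed.

Lemma sub_aff S : S `<=` aff S.
Proof. exact: sub_gen_smallest. Qed.

(** The point [a + t v] is on the line through [a] and [a + v], and [a + u + v] is the midpoint of
    [a + 2 u] and [a + 2 v]. *)
Lemma affine_set_directions A (a : X) : affine_set A -> A a ->
  subspace_set [set v | A (a + v)].
Proof.
move=> affA Aa.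
have AZ (t : R) v : A (a + v) -> A (a + t *: v).
  move=> Av; have := affA _ _ t Aa Av.
  by rewrite scalerDr addrA -scalerDl subrK scale1r.
split=> //=; first by rewrite addr0.
move=> u v Au Av; have := affA _ _ 2^-1 (AZ 2 _ Au) (AZ 2 _ Av).
rewrite !scalerDr !scalerA mulVf ?pnatr_eq0//.
have -> : (1 - 2^-1 : R) = 2^-1 by field.
rewrite mulVf ?pnatr_eq0// !scale1r addrACA -scalerDl.
by rewrite (_ : 2^-1 + 2^-1 = 1 :> R) ?scale1r//; field.
Qed.

Lemma ri_ball S (a : X) : ri S a -> exists2 r : R, 0 < r &
  forall z, closure (aff S) z -> `|z - a| < r -> S z.
Proof.
move=> Sa.
have Saa : S a by exact: interior_subset Sa.
have affa : closure (aff S) a by apply: subset_closure; exact: sub_aff.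
move: Sa; rewrite /ri /interior /= /nbhs /= -nbhs_subspace_in//.
rewrite /within /= => /nbhs_ballP[r /= r0 ar]; exists r => // z az zr.
by apply: ar => //; rewrite -ball_normE /= distrC.
Qed.

(** Contracting a point [z] of the closure towards [a], to distance [r / 2], lands in [S]; then [z]
    is on the line through [a] and a point of [S]. *)
Lemma closed_aff S (a : X) : ri S a -> closed (aff S).
Proof.
move=> Sa; have [r r0 Sr] := ri_ball Sa.
have aS : aff S a by apply: sub_aff; apply: interior_subset Sa.
move=> z clz.
have [->//|za] := eqVneq z a.
have nza : 0 < `|z - a| by rewrite normr_gt0 subr_eq0.
pose t := r / 2 / `|z - a|.
have t0 : 0 < t by rewrite !divr_gt0.
pose g (w : X) : X := (1 - t) *: a + t *: w.
have cg : continuous g.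
  move=> w; apply: cvgD; first exact: cvg_cst.
  by apply: cvgZr; exact: cvg_id.
have clgz : closure (aff S) (g z).
  move=> B /cg/clz[w [Sw Bw]]; exists (g w); split=> //.
  exact: affine_set_aff.
have gza : g z - a = t *: (z - a).
  by rewrite /g scalerBl scale1r scalerBr addrAC [a - _]addrC addrK addrC.
have Sgz : aff S (g z).
  apply: sub_aff; apply: Sr => //.
  rewrite gza normrZ gtr0_norm// divfK ?gt_eqF//; lra.
have := affine_set_aff t^-1 aS Sgz.
have -> // : (1 - t^-1) *: a + t^-1 *: g z = z.
rewrite -[g z](subrK a) gza scalerDr scalerK ?gt_eqF//.
by rewrite addrCA -scalerDl subrK scale1r subrK.
Qed.

End affine_theory.

(** * Local bounds for monotone operators along the affine hull *)

Section monotone_theory.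
Context {R : realType} {X : completeNormedModType R}.
Implicit Type T : X -> set (topdual X).

(** For [a + v] in the domain and [b] in [T (a + v)], monotonicity gives
    [q v <= q (p - a) + b (a + v - p)]; uniform boundedness is applied to the
    functionals [q / (1 + |q (p - a)|)]. *)
Lemma monotone_relative_bound T (L : set X) (a x : X) (r : R) :
  monotone_op T -> subspace_set L -> closed L -> 0 < r ->
  (forall v, L v -> `|v| < r -> domain T (a + v)) ->
  exists2 K : R, 0 <= K & forall p q, T p q -> `|p - x| <= 1 ->
    forall v, L v -> q v <= K * `|v| * (1 + `|q (p - a)|).
Proof.
move=> monT sL clL r0 domT; have [_ _ LZ] := sL.
pose F : set (topdual X) := [set (1 + `|pq.2 (pq.1 - a)|)^-1 *: pq.2 |
  pq in [set pq : X * topdual X | T pq.1 pq.2 /\ `|pq.1 - x| <= 1]].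
have d0 (q : topdual X) v : 0 < 1 + `|q v| by rewrite ltr_pwDl.
have FE (c : R) (q : topdual X) v : (c *: q) v = c * q v by [].
have Fbd v : L v -> exists M : R, forall f, F f -> f v <= M.
  move=> Lv; pose t := r / 2 / (`|v| + 1).
  have v1 : 0 < `|v| + 1 by rewrite ltr_pwDr.
  have t0 : 0 < t by rewrite !divr_gt0.
  have tvr : `|t *: v| < r.
    rewrite normrZ gtr0_norm// /t mulrAC ltr_pdivrMr//.
    have := normr_ge0 v; nra.
  have [b Tb] := domT _ (LZ t _ Lv) tvr.
  have [N N0 bN] := topdual_bounded b.
  (* [N] bounds [b (x - p)] because [|p - x| <= 1]; the summand 1 absorbs [q (p - a)] after the
     normalization. *)
  exists (t^-1 * (1 + `|b (a + t *: v - x)| + N)) => _ [[p q] [/= Tpq px] <-].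
  rewrite FE ler_pdivrMl// mulrCA ler_pdivlMl// -topdualZ.
  have := monT _ _ _ _ Tb Tpq.
  have -> : (b - q) (a + t *: v - p) = b (a + t *: v - p) - q (a + t *: v - p).
    by [].
  have -> : b (a + t *: v - p) = b (a + t *: v - x) - b (p - x).
    by rewrite -topdualB opprB addrA subrK.
  have -> : q (a + t *: v - p) = q (t *: v) - q (p - a).
    by rewrite -topdualB opprB addrA (addrC a).
  have bpx : - b (p - x) <= N.
    rewrite -topdualN; apply: le_trans (ler_norm _) _.
    apply: le_trans (bN _) _; rewrite normrN.
    by rewrite -[leRHS]mulr1 ler_wpM2l.
  have := ler_norm (b (a + t *: v - x)); have := ler_norm (q (p - a)).
  have := normr_ge0 (q (p - a)); have := normr_ge0 (b (a + t *: v - x)).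
  move: bpx; nra.
have [K K0 FK] := closed_subspace_uniform_boundedness sL clL Fbd.
exists K => // p q Tpq px v Lv.
have /FK/(_ _ Lv) : F ((1 + `|q (p - a)|)^-1 *: q) by exists (p, q).
by rewrite FE ler_pdivrMl// mulrC.
Qed.

(** Near a limit point the bound of [monotone_relative_bound] is
    self-improving: once [|p - x|] is small, [q (p - x)] is absorbed by the
    left-hand side. *)
Lemma monotone_absorbed_bound T (L : set X) (a x : X) (r B : R) :
  monotone_op T -> subspace_set L -> closed L -> 0 < r -> 0 <= B ->
  (forall v, L v -> `|v| < r -> domain T (a + v)) ->
  exists C e : R, [/\ 0 <= C, 0 < e & forall p q, T p q -> L (p - x) ->
    `|p - x| <= e -> `|q (x - a)| <= B -> forall v, L v -> q v <= C * `|v|].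
Proof.
move=> monT sL clL r0 B0 domT; have [_ _ LZ] := sL.
have [K K0 hK] := monotone_relative_bound x monT sL clL r0 domT.
have K1 : 0 < 2 * (K + 1) by rewrite mulr_gt0// ltr_pwDr.
(* This radius [e] gives [K e <= 1/2], hence [|q (p - a)| <= (1 + |q (p - a)|) / 2 + B], that is,
   [1 + |q (p - a)| <= 2 + 2 B]. *)
exists (K * (2 + 2 * B)), (2 * (K + 1))^-1; split.
- by rewrite mulr_ge0// addr_ge0// mulr_ge0.
- by rewrite invr_gt0.
move=> p q Tpq Lpx pxe qxa v Lv.
have px1 : `|p - x| <= 1.
  by apply: le_trans pxe _; rewrite invf_le1//; lra.
have hq := hK p q Tpq px1.
have Kpx : K * `|p - x| <= 2^-1.
  apply: le_trans (ler_wpM2l K0 pxe) _.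
  by rewrite ler_pdivrMr//; lra.
have d0 : 0 < 1 + `|q (p - a)| by rewrite ltr_pwDl.
have qpx : `|q (p - x)| <= 2^-1 * (1 + `|q (p - a)|).
  rewrite ler_norml; apply/andP; split.
    rewrite lerNl -topdualN.
    have LN : L (- (p - x)) by rewrite -scaleN1r; exact: LZ.
    apply: le_trans (hq _ LN) _.
    by rewrite normrN ler_wpM2r// ltW.
  apply: le_trans (hq _ Lpx) _.
  by rewrite ler_wpM2r// ltW.
have qpa : `|q (p - a)| <= `|q (p - x)| + `|q (x - a)|.
  have -> : p - a = (p - x) + (x - a) by rewrite addrA subrK.
  by rewrite topdualD ler_normD.
apply: le_trans (hq _ Lv) _.
have -> : K * (2 + 2 * B) * `|v| = K * `|v| * (2 + 2 * B) by ring.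
by rewrite ler_wpM2l ?mulr_ge0//; lra.
Qed.

(** Such an [f] takes a single value on the affine hull. With [T = T + N], it may therefore be added
    to any element of [T p]. *)
Lemma normal_cone_aff_annihilator (D : set X) (a p : X) (f : topdual X) :
  aff D a -> aff D p -> (forall v, aff D (a + v) -> f v = 0) ->
  normal_cone (aff D) p f.
Proof.
move=> Da Dp f0; split=> // y Dy.
have f0' z : aff D z -> f (z - a) = 0.
  by move=> Dz; apply: f0; rewrite addrC subrK.
have -> : y - p = (y - a) - (p - a) by rewrite opprB addrA subrK.
by rewrite topdualB !f0'// subrr.
Qed.

End monotone_theory.

(** * Closedness of the graph *)

Unset Implicit Arguments.
Set Strict Implicit.

Theorem theorem37 (R : realType) (X : completeNormedModType R)
    (X_neq0 : exists x : X, x != 0)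
    (T : X -> set (topdual X))
    (T_neq0 : graph T !=set0)
    (T_monotone : monotone_op T)
    (T_demiclosed : demiclosed T)
    (domT_not_singleton : ~ exists a : X, domain T = [set a])
    (ri_domT_neq0 : ri (domain T) !=set0)
    (T_add_normal : T = add_op T (normal_cone (aff (domain T)))) :
  closed (graph T : set (X * weak_star X)).
Proof.
move=> [x xs] clT; rewrite /graph /=.
have [a ria] := ri_domT_neq0.
have [r r0 ballD] := ri_ball ria.
have clA := closed_aff ria.
set A := aff (domain T) in ballD clA.
have domA p q : T p q -> A p by move=> Tpq; apply: sub_aff; exists q.
have Aa : A a by apply: sub_aff; exact: interior_subset ria.
pose L := [set v | A (a + v)].
have affA : affine_set A by exact: affine_set_aff.
have sL : subspace_set L by exact: affine_set_directions.
have [_ LD LZ] := sL.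
have LB u v : L u -> L v -> L (u - v).
  by move=> Lu Lv; rewrite -scaleN1r; apply: LD => //; exact: LZ.
have Ldir y : A y -> L (y - a) by rewrite /L /= addrC subrK.
have clL : closed L.
  apply: (@closed_comp _ _ (fun v => a + v) A) => // v _.
  by apply: cvgD; [exact: cvg_cst|exact: cvg_id].
have domL v : L v -> `|v| < r -> domain T (a + v).
  move=> Lv vr; apply: ballD; first exact: subset_closure.
  by rewrite addrC addKr.
(* Membership in [T p] depends only on the restriction to [L]. *)
have T_perp p (q f : topdual X) :
    T p q -> (forall v, L v -> f v = q v) -> T p f.
  move=> Tpq fq; rewrite T_add_normal; exists q => //.
  exists (f - q); last by rewrite addrC subrK.
  apply: (normal_cone_aff_annihilator Aa (domA _ _ Tpq)) => v Lv.
  by rewrite -[LHS]/(f v - q v) fq// subrr.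
have GF : ProperFilter
    (within (graph T) (nbhs ((x, xs) : X * weak_star X))).
  exact: (@within_nbhs_proper (X * weak_star X)%type (graph T) (x, xs) clT).
have [U [UU GU]] := ultraFilterLemma GF.
have nbhsU (B : set (X * weak_star X)) : nbhs (x, xs) B -> U B.
  by move=> hB; apply: GU; rewrite /within /=; apply: filterS hB.
have UT : \forall pq \near U, T pq.1 pq.2 by apply: GU; exact: withinT.
have Ux : pq.1 @[pq --> U] --> x.
  move=> B Bx; apply: nbhsU; exists (B, setT); last by move=> pq [].
  by split=> //; exact: filterT.
have Uxs v : (pq.2 : topdual X) v @[pq --> U] --> xs v.
  move=> B Bx; apply: nbhsU.
  exists (setT, [set f : weak_star X | B (topdual_fun f v)]).
    by split; [exact: filterT|exact: (weak_star_eval_continuous Bx)].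
  by move=> pq [].
have Ax : A x.
  apply: (closed_cvg A _ _ _ Ux) => //.
  by apply: filterS UT => pq; exact: domA.
(* Along [U], [q (x - a)] is eventually within 1 of [xs (x - a)], hence this value of [B]. *)
have B0 : 0 <= `|xs (x - a)| + 1 by rewrite addr_ge0.
have [C [e [C0 e0 hC]]] :=
  monotone_absorbed_bound x T_monotone sL clL r0 B0 domL.
pose Lbd (q : topdual X) := forall v, L v -> q v <= C * `|v|.
have Ubd : \forall pq \near U, Lbd pq.2.
  have /cvgrPdist_le/(_ _ e0) Ue := Ux.
  have /cvgrPdist_le/(_ _ ltr01) U1 := Uxs (x - a).
  near=> pq; rewrite /Lbd; apply: (hC pq.1); first by near: pq.
  - have -> : pq.1 - x = (pq.1 - a) - (x - a) by rewrite opprB addrA subrK.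
    apply: LB; apply: Ldir => //; apply: (domA _ pq.2); by near: pq.
  - by rewrite distrC; near: pq.
  have : `|xs (x - a) - (pq.2 : topdual X) (x - a)| <= 1 by near: pq.
  rewrite distrC => h; rewrite -[X in `|X|](subrK (xs (x - a))).
  by apply: le_trans (ler_normD _ _) _; rewrite addrC lerD2l.
pose ext (q f : topdual X) :=
  (forall v, L v -> f v = q v) /\ forall v, `|f v| <= C * `|v|.
(* Where the bound fails, [g] takes the default value [pq.2]; this does not affect limits along
   [U]. *)
have /choice[g gP] (pq : X * weak_star X) :
    exists f, Lbd pq.2 -> ext pq.2 f.
  have [h|nh] := pselect (Lbd pq.2); last by exists pq.2 => /nh.
  by have [f fP] := topdual_extension sL C0 h; exists f.
have [y gy] : exists y : topdual X, forall v, g pq v @[pq --> U] --> y v.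
  apply: (@topdual_ultra_limit _ _ _ _ _ g C).
  by apply: filterS Ubd => pq /gP[].
apply: (T_perp x y).
  apply: (@demiclosed_filter _ _ T _ U _ (fun pq => pq.1) g x y C) => //.
  near=> pq; have h : Lbd pq.2 by near: pq.
  have [gL gC] := gP _ h; split=> //.
  by apply: (T_perp _ pq.2) => //; near: pq.
(* On [L], eventually [g pq v = pq.2 v], so the limits [y v] and [xs v] coincide. *)
move=> v Lv; apply/esym; apply: (cvg_unique _ (gy v)); first exact: Rhausdorff.
apply: cvg_trans (Uxs v); apply: near_eq_cvg.
by near=> pq; rewrite (gP pq _).1//; near: pq.
Unshelve. all: by end_near. Qed.
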